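(* Let $\mathfrak{U}$ be a universe and let $\mathcal{C}$ be a light category. Then $\beta = (\beta_{c,F})$ is a natural isomorphism from the composite functor $$\mathcal{C}^{\mathrm{op}} \times [\mathcal{C}^{\mathrm{op}},\mathbf{Set}] \xrightarrow{\ \mathsf{app}\ } \mathbf{Set} \hookrightarrow \mathbf{Class}_2$$ to the composite functor $$\mathcal{C}^{\mathrm{op}} \times [\mathcal{C}^{\mathrm{op}},\mathbf{Set}] \xrightarrow{\ \mathcal{Y}^{\mathrm{op}} \times [\mathcal{C}^{\mathrm{op}},\mathbf{Set}]\ } [\mathcal{C}^{\mathrm{op}},\mathbf{Set}]^{\mathrm{op}} \times [\mathcal{C}^{\mathrm{op}},\mathbf{Set}] \xrightarrow{\ \mathsf{hom}\ } \mathbf{Class}_2 .$$ (In particular the homsets of $[\mathcal{C}^{\mathrm{op}},\mathbf{Set}]$ are $2$-classes, so that $\mathsf{hom}$ takes values in $\mathbf{Class}_2$.)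
   Context: The setting is ZFC. A universe is a set $\mathfrak{U}$ such that: every set in $\mathfrak{U}$ is a subset of $\mathfrak{U}$; $\emptyset \in \mathfrak{U}$; $x,y \in \mathfrak{U}$ implies $\{x,y\} \in \mathfrak{U}$; if $I \in \mathfrak{U}$ and $(A_i)_{i \in I}$ is a family of sets in $\mathfrak{U}$ then $\bigcup_{i\in I}A_i \in \mathfrak{U}$; $A \in \mathfrak{U}$ implies $\mathcal{P}A \in \mathfrak{U}$. (Universes need not contain $\mathbb{N}$.) A set is small when it is an element of $\mathfrak{U}$; a class is a subset of $\mathfrak{U}$. A category (set of objects, family of homsets that are sets, composition and identities) is light when its set of objects is a class and every homset is small. $\mathbf{Set}$ is the category of small sets and functions. Pairs $(x,y)$ are Kuratowski pairs $\{\{x\},\{x,y\}\}$, and a family $(x_i)_{i \in I}$ is the set $\{(i,x_i) \mid i \in I\}$. For a set of sets $A$, the set $\Psi A$ is the least set such that: if $x \in \mathfrak{U}$ then $x \in \Psi A$; if $I \in A$ then $I \in \Psi A$; if $x,y \in \Psi A$ then $(x,y) \in \Psi A$; if $I \in A$ and $x_i \in \Psi A$ for all $i \in I$, then $(x_i)_{i\in I} \in \Psi A$. Let $\tilde{\mathfrak{U}}$ be the set of sets in $\mathfrak{U}$ (which in ZFC is $\mathfrak{U}$ itself). For $k \in \mathbb{N}$, a $k$-class is an element of $(\mathcal{P}\Psi)^k\tilde{\mathfrak{U}}$, i.e. of the result of applying the operation $A \mapsto \mathcal{P}(\Psi A)$ $k$ times to $\tilde{\mathfrak{U}}$; $\mathbf{Class}_k$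 is the category of $k$-classes and functions. Every small set is a $2$-class, giving the inclusion $\mathbf{Set} \hookrightarrow \mathbf{Class}_2$. Functions, functors and natural transformations are not tagged with domain and codomain: a function $A \to B$ is the family $(f(a))_{a \in A}$, and a natural transformation is the family of its components indexed by the objects of its source category. $[\mathcal{C}^{\mathrm{op}},\mathbf{Set}]$ is the category of functors $\mathcal{C}^{\mathrm{op}} \to \mathbf{Set}$ and natural transformations. $\mathcal{Y}\colon \mathcal{C} \to [\mathcal{C}^{\mathrm{op}},\mathbf{Set}]$ is the Yoneda functor $\mathcal{Y}c = \mathcal{C}(-,c)$; $\mathsf{app}$ is the evaluation functor $(c,F) \mapsto Fc$; $\mathsf{hom}$ is the hom-functor $(F,G) \mapsto [\mathcal{C}^{\mathrm{op}},\mathbf{Set}](F,G)$. For $c \in \mathcal{C}$, $F\colon\mathcal{C}^{\mathrm{op}} \to \mathbf{Set}$ and $x \in Fc$, $\beta_{c,F}(x) \colon \mathcal{Y}c \to F$ is the natural transformation whose component at $a \in \mathcal{C}$ sends $f \in \mathcal{C}(a,c)$ to $(Ff)(x) \in Fa$. *)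

(* Defs.v *)
From Stdlib Require Import ClassicalEpsilon.

Set Implicit Arguments.
Unset Strict Implicit.

(* A model of ZFC.  The schemas of separation and replacement range over all
   predicates and relations of the ambient logic. *)
Record zfc : Type := ZFC {
  set :> Type;
  mem : set -> set -> Prop;
  zfc_ext : forall X Y, (forall x, mem x X <-> mem x Y) -> X = Y;
  zfc_foundation : forall X, (exists x, mem x X) ->
    exists x, mem x X /\ forall y, ~ (mem y x /\ mem y X);
  zfc_pairing : forall x y, exists X, forall z, mem z X <-> z = x \/ z = y;
  zfc_union : forall X, exists Y,
    forall z, mem z Y <-> exists x, mem x X /\ mem z x;
  zfc_power : forall X, exists Y,
    forall z, mem z Y <-> forall x, mem x z -> mem x X;
  zfc_infinity : exists N,
    (exists e, mem e N /\ forall x, ~ mem x e) /\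
    (forall n, mem n N -> exists m, mem m N /\
       forall x, mem x m <-> mem x n \/ x = n);
  zfc_separation : forall X (P : set -> Prop), exists Y,
    forall x, mem x Y <-> mem x X /\ P x;
  zfc_replacement : forall X (R : set -> set -> Prop),
    (forall x y y', mem x X -> R x y -> R x y' -> y = y') ->
    exists Y, forall y, mem y Y <-> exists x, mem x X /\ R x y;
  zfc_choice : forall X,
    (forall x, mem x X -> exists y, mem y x) ->
    (forall x y z, mem x X -> mem y X -> mem z x -> mem z y -> x = y) ->
    exists S, forall x, mem x X -> exists! y, mem y x /\ mem y S
}.

Declare Scope zfc_scope.
Delimit Scope zfc_scope with zfc.
Local Open Scope zfc_scope.
Notation "x \in A" := (mem x A) (at level 70, no associativity) : zfc_scope.

Section Sets.
Context {V : zfc}.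
Implicit Types (A B I X Y x y z : V).

Lemma zfc_inhabited : inhabited V.
Proof. destruct (zfc_infinity V) as [N _]. exact (inhabits N). Qed.

(* Definite description; meaningful when exactly one set satisfies [P]. *)
Definition the (P : V -> Prop) : V := epsilon zfc_inhabited P.

Lemma the_eq (P : V -> Prop) x :
  P x -> (forall y, P y -> y = x) -> the P = x.
Proof.
intros Hx Hu. apply Hu. exact (epsilon_spec _ P (ex_intro _ x Hx)).
Qed.

(* The set {x | P x}.  It is only used for predicates whose extension is
   bounded by a set; each use is justified by a membership lemma. *)
Definition setof (P : V -> Prop) : V := the (fun X => forall x, x \in X <-> P x).

Definition bounded (P : V -> Prop) : Prop := exists X, forall x, P x -> x \in X.

Lemma mem_setof (P : V -> Prop) : bounded P -> forall x, x \in setof P <-> P x.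
Proof.
intros [X HX]. destruct (zfc_separation X P) as [Y HY].
refine (epsilon_spec _ (fun X => forall x, x \in X <-> P x) (ex_intro _ Y _)).
intros x. rewrite HY. split; [tauto | intros Hx; split; auto].
Qed.

Definition subset A B : Prop := forall x, x \in A -> x \in B.

Definition empty : V := setof (fun _ => False).

Definition upair x y : V := setof (fun z => z = x \/ z = y).

Definition power A : V := setof (fun X => subset X A).

(* The union of the family of sets (A i) indexed by the elements i of I. *)
Definition bigcup I (A : V -> V) : V :=
  setof (fun x => exists i, i \in I /\ x \in A i).

Definition pair x y : V := upair (upair x x) (upair x y).

Definition fst (p : V) : V := the (fun x => exists y, p = pair x y).

Definition snd (p : V) : V := the (fun y => exists x, p = pair x y).

Definition prod A B : V :=
  setof (fun p => exists x y, x \in A /\ y \in B /\ p = pair x y).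

(* The family (g i) indexed by the elements i of I; by replacement, every
   family in the sense of set theory is of this form, so quantifying over
   functions V -> V amounts to quantifying over families. *)
Definition fam I (g : V -> V) : V :=
  setof (fun p => exists i, i \in I /\ p = pair i (g i)).

(* The component at i of the family (or function) f. *)
Definition app (f i : V) : V := the (fun y => pair i y \in f).

(* The set of functions from A to B, which carry no codomain. *)
Definition functions A B : V :=
  setof (fun f => exists g, (forall x, x \in A -> g x \in B) /\ f = fam A g).

Lemma mem_empty x : ~ x \in empty.
Proof.
unfold empty. rewrite mem_setof; [tauto|].
destruct zfc_inhabited as [X]. exists X. tauto.
Qed.

Lemma mem_upair x y z : z \in upair x y <-> z = x \/ z = y.
Proof.
apply (mem_setof (P := fun z => z = x \/ z = y)).
destruct (zfc_pairing x y) as [X HX].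
exists X. intros t Ht. apply HX, Ht.
Qed.

Lemma mem_power A X : X \in power A <-> subset X A.
Proof.
apply (mem_setof (P := fun X => subset X A)).
destruct (zfc_power A) as [Y HY].
exists Y. intros t Ht. apply HY, Ht.
Qed.

Lemma mem_bigcup I (A : V -> V) x :
  x \in bigcup I A <-> exists i, i \in I /\ x \in A i.
Proof.
apply (mem_setof (P := fun x => exists i, i \in I /\ x \in A i)).
destruct (zfc_replacement (X := I) (R := fun i y => y = A i)) as [Y HY].
{ intros i y y' _ -> ->. reflexivity. }
destruct (zfc_union Y) as [Z HZ].
exists Z. intros t (i & Hi & Ht). apply HZ. exists (A i). split; [|exact Ht].
apply HY. exists i. auto.
Qed.

Lemma pair_inj x y x' y' : pair x y = pair x' y' -> x = x' /\ y = y'.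
Proof.
intros E.
assert (M : forall z, (z = upair x x \/ z = upair x y) <->
                      (z = upair x' x' \/ z = upair x' y')).
{ intros z. rewrite <- !mem_upair. fold (pair x y) (pair x' y').
  rewrite E. tauto. }
assert (U : forall a b c d : V, upair a b = upair c d ->
   (a = c \/ a = d) /\ (b = c \/ b = d) /\ (c = a \/ c = b) /\ (d = a \/ d = b)).
{ intros a b c d H.
  assert (N : forall z, (z = a \/ z = b) <-> (z = c \/ z = d))
    by (intros z; rewrite <- !mem_upair, H; tauto).
  repeat split; apply N; auto. }
assert (Hx : x = x').
{ destruct (proj1 (M (upair x x)) (or_introl eq_refl)) as [H|H];
    apply U in H; destruct H as (H1 & H2 & H3 & H4);
    destruct H3; congruence. }
subst x'. split; [reflexivity|].
destruct (proj1 (M (upair x y)) (or_intror eq_refl)) as [H|H];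
  destruct (proj2 (M (upair x y')) (or_intror eq_refl)) as [H'|H'];
  apply U in H; apply U in H';
  destruct H as (H1 & H2 & H3 & H4), H' as (K1 & K2 & K3 & K4);
  destruct H2, H4, K2, K4; congruence.
Qed.

Lemma fst_pair x y : fst (pair x y) = x.
Proof.
apply the_eq; [exists y; reflexivity|].
intros z [t E]. apply pair_inj in E. symmetry. apply E.
Qed.

Lemma snd_pair x y : snd (pair x y) = y.
Proof.
apply the_eq; [exists x; reflexivity|].
intros z [t E]. apply pair_inj in E. symmetry. apply E.
Qed.

Lemma mem_prod A B p :
  p \in prod A B <-> exists x y, x \in A /\ y \in B /\ p = pair x y.
Proof.
apply (mem_setof
  (P := fun p => exists x y, x \in A /\ y \in B /\ p = pair x y)).
exists (bigcup A (fun x => bigcup B (fun y => upair (pair x y) (pair x y)))).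
intros t (x & y & Hx & Hy & ->).
rewrite mem_bigcup. exists x. split; [exact Hx|].
rewrite mem_bigcup. exists y. split; [exact Hy|].
rewrite mem_upair. auto.
Qed.

Lemma mem_fam I (g : V -> V) p :
  p \in fam I g <-> exists i, i \in I /\ p = pair i (g i).
Proof.
apply (mem_setof (P := fun p => exists i, i \in I /\ p = pair i (g i))).
exists (bigcup I (fun i => upair (pair i (g i)) (pair i (g i)))).
intros t (i & Hi & ->). rewrite mem_bigcup. exists i.
rewrite mem_upair. auto.
Qed.

Lemma app_fam I (g : V -> V) i : i \in I -> app (fam I g) i = g i.
Proof.
intros Hi. apply the_eq.
- apply mem_fam. exists i. auto.
- intros y Hy. apply mem_fam in Hy. destruct Hy as (j & _ & E).
  apply pair_inj in E. destruct E as [-> ->]. reflexivity.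
Qed.

Lemma fam_ext I (g h : V -> V) :
  (forall i, i \in I -> g i = h i) -> fam I g = fam I h.
Proof.
intros E. apply zfc_ext. intros p. rewrite !mem_fam.
split; intros (i & Hi & ->); exists i; rewrite E by exact Hi; auto.
Qed.

(* Families with index set [I] all of whose components lie in a fixed set. *)
Lemma bounded_fam I B :
  bounded (fun f => exists g, (forall x, x \in I -> g x \in B) /\ f = fam I g).
Proof.
exists (power (prod I B)). intros f (g & Hg & ->).
apply mem_power. intros p Hp. apply mem_fam in Hp. destruct Hp as (i & Hi & ->).
apply mem_prod. exists i, (g i). auto.
Qed.

Lemma mem_functions A B f :
  f \in functions A B <->
  exists g, (forall x, x \in A -> g x \in B) /\ f = fam A g.
Proof.
apply (mem_setof
  (P := fun f => exists g, (forall x, x \in A -> g x \in B) /\ f = fam A g)).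
apply bounded_fam.
Qed.

Definition universe (U : V) : Prop :=
  (forall x, x \in U -> subset x U) /\
  empty \in U /\
  (forall x y, x \in U -> y \in U -> upair x y \in U) /\
  (forall I (A : V -> V), I \in U -> (forall i, i \in I -> A i \in U) ->
     bigcup I A \in U) /\
  (forall A, A \in U -> power A \in U).

Definition Psi_closed (U A P : V) : Prop :=
  (forall x, x \in U -> x \in P) /\
  (forall I, I \in A -> I \in P) /\
  (forall x y, x \in P -> y \in P -> pair x y \in P) /\
  (forall I (x : V -> V), I \in A -> (forall i, i \in I -> x i \in P) ->
     fam I x \in P).

(* The least set closed under the four clauses. *)
Definition Psi (U A : V) : V :=
  the (fun P => Psi_closed U A P /\ forall Q, Psi_closed U A Q -> subset P Q).

(* Everything is a set here, so that the set of sets in U is U itself. *)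
Definition classes (U : V) (k : nat) : V :=
  Nat.iter k (fun A => power (Psi U A)) U.

End Sets.

(* Homsets need not be disjoint, so the composition of g : b -> c with
   f : a -> b also depends on a, b, c.  The values of [hom], [idm] and [comp]
   away from the relevant sets play no role. *)
Record category (V : zfc) : Type := Category {
  ob : V;
  hom : V -> V -> V;
  idm : V -> V;
  comp : V -> V -> V -> V -> V -> V;
  idm_hom : forall a, a \in ob -> idm a \in hom a a;
  comp_hom : forall a b c g f, a \in ob -> b \in ob -> c \in ob ->
    g \in hom b c -> f \in hom a b -> comp a b c g f \in hom a c;
  comp_idl : forall a b f, a \in ob -> b \in ob -> f \in hom a b ->
    comp a b b (idm b) f = f;
  comp_idr : forall a b f, a \in ob -> b \in ob -> f \in hom a b ->
    comp a a b f (idm a) = f;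
  comp_assoc : forall a b c d h g f,
    a \in ob -> b \in ob -> c \in ob -> d \in ob ->
    h \in hom c d -> g \in hom b c -> f \in hom a b ->
    comp a c d h (comp a b c g f) = comp a b d (comp b c d h g) f
}.

Section Categories.
Context {V : zfc}.
Implicit Types (C D E : category V) (F G H : V).

Definition light (U : V) C : Prop :=
  subset (ob C) U /\
  (forall a b, a \in ob C -> b \in ob C -> hom C a b \in U).

Definition is_iso C (a b f : V) : Prop :=
  f \in hom C a b /\
  exists g, g \in hom C b a /\
    comp C a b a g f = idm C a /\ comp C b a b f g = idm C b.

Definition op C : category V.
Proof.
refine {| ob := ob C;
          hom := fun a b => hom C b a;
          idm := idm C;
          comp := fun a b c g f => comp C c b a f g |}.
- intros a Ha. apply idm_hom, Ha.
- intros a b c g f Ha Hb Hc Hg Hf. apply comp_hom; assumption.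
- intros a b f Ha Hb Hf. apply comp_idr; assumption.
- intros a b f Ha Hb Hf. apply comp_idl; assumption.
- intros a b c d h g f Ha Hb Hc Hd Hh Hg Hf. symmetry.
  apply comp_assoc; assumption.
Defined.

Definition prod_cat C D : category V.
Proof.
refine {| ob := prod (ob C) (ob D);
          hom := fun p q => prod (hom C (fst p) (fst q)) (hom D (snd p) (snd q));
          idm := fun p => pair (idm C (fst p)) (idm D (snd p));
          comp := fun p q r g f =>
            pair (comp C (fst p) (fst q) (fst r) (fst g) (fst f))
                 (comp D (snd p) (snd q) (snd r) (snd g) (snd f)) |};
repeat match goal with
| |- forall _, _ => intros ?
| H : mem _ (prod _ _) |- _ =>
    apply mem_prod in H; destruct H as (? & ? & ? & ? & ->);
    rewrite ?fst_pair, ?snd_pair in *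
end.
- apply mem_prod. do 2 eexists. split; [|split; [|reflexivity]];
    apply idm_hom; assumption.
- apply mem_prod. do 2 eexists. split; [|split; [|reflexivity]];
    apply comp_hom; assumption.
- rewrite !comp_idl by assumption. reflexivity.
- rewrite !comp_idr by assumption. reflexivity.
- rewrite !comp_assoc by assumption. reflexivity.
Defined.

Definition set_cat (X : V) : category V.
Proof.
refine {| ob := X;
          hom := functions;
          idm := fun A => fam A (fun x => x);
          comp := fun A B Z g f => fam A (fun x => app g (app f x)) |};
repeat match goal with
| |- forall _, _ => intros ?
| H : mem _ (functions _ _) |- _ =>
    apply mem_functions in H; destruct H as (? & ? & ->)
end.
- apply mem_functions. eexists. split; [|reflexivity].
  intros z Hz. exact Hz.
- apply mem_functions. eexists. split; [|reflexivity].
  intros z Hz. cbv beta. rewrite (app_fam _ Hz), app_fam; auto.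
- apply fam_ext. intros z Hz. rewrite !(app_fam _ Hz), app_fam; auto.
- apply fam_ext. intros z Hz. rewrite !(app_fam _ Hz). reflexivity.
- apply fam_ext. intros z Hz. rewrite !(app_fam _ Hz), !app_fam; auto;
  rewrite app_fam; auto.
Defined.

(* A functor is the pair of the family of its values on objects and the family,
   indexed by the pairs of objects of the source, of its actions on homsets.
   It carries neither its source nor its target. *)
Definition mk_functor D (F0 : V -> V) (F1 : V -> V -> V -> V) : V :=
  pair (fam (ob D) F0)
       (fam (prod (ob D) (ob D)) (fun p =>
          fam (hom D (fst p) (snd p)) (F1 (fst p) (snd p)))).

Definition fobj F (a : V) : V := app (fst F) a.

Definition fmap F (a b f : V) : V := app (app (snd F) (pair a b)) f.

Definition is_functor D E F : Prop :=
  (exists (F0 : V -> V) (F1 : V -> V -> V -> V), F = mk_functor D F0 F1) /\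
  (forall a, a \in ob D -> fobj F a \in ob E) /\
  (forall a b f, a \in ob D -> b \in ob D -> f \in hom D a b ->
     fmap F a b f \in hom E (fobj F a) (fobj F b)) /\
  (forall a, a \in ob D -> fmap F a a (idm D a) = idm E (fobj F a)) /\
  (forall a b c g f, a \in ob D -> b \in ob D -> c \in ob D ->
     g \in hom D b c -> f \in hom D a b ->
     fmap F a c (comp D a b c g f) =
     comp E (fobj F a) (fobj F b) (fobj F c) (fmap F b c g) (fmap F a b f)).

(* [t] is the family of components, indexed by the objects of D. *)
Definition is_nat_trans D E F G (t : V) : Prop :=
  (exists g, t = fam (ob D) g) /\
  (forall a, a \in ob D -> app t a \in hom E (fobj F a) (fobj G a)) /\
  (forall a b f, a \in ob D -> b \in ob D -> f \in hom D a b ->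
     comp E (fobj F a) (fobj F b) (fobj G b) (app t b) (fmap F a b f) =
     comp E (fobj F a) (fobj G a) (fobj G b) (fmap G a b f) (app t a)).

Definition is_nat_iso D E F G (t : V) : Prop :=
  is_functor D E F /\ is_functor D E G /\ is_nat_trans D E F G t /\
  (forall a, a \in ob D -> is_iso E (fobj F a) (fobj G a) (app t a)).

Definition functors D E : V := setof (is_functor D E).

Definition nat_trans D E F G : V := setof (is_nat_trans D E F G).

Lemma fobj_mk D (F0 : V -> V) (F1 : V -> V -> V -> V) a :
  a \in ob D -> fobj (mk_functor D F0 F1) a = F0 a.
Proof.
intros Ha. unfold fobj, mk_functor. rewrite fst_pair. apply app_fam, Ha.
Qed.

Lemma fmap_mk D (F0 : V -> V) (F1 : V -> V -> V -> V) a b f :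
  a \in ob D -> b \in ob D -> f \in hom D a b ->
  fmap (mk_functor D F0 F1) a b f = F1 a b f.
Proof.
intros Ha Hb Hf. unfold fmap, mk_functor. rewrite snd_pair.
rewrite app_fam by (apply mem_prod; exists a, b; auto).
rewrite fst_pair, snd_pair. apply app_fam, Hf.
Qed.

Lemma mem_functors D E F : F \in functors D E <-> is_functor D E F.
Proof.
apply (mem_setof (P := is_functor D E)).
set (X := bigcup (ob D) (fun a => bigcup (ob D) (fun b => hom D a b))).
set (Y := bigcup (ob E) (fun a => bigcup (ob E) (fun b => hom E a b))).
exists (prod (functions (ob D) (ob E))
             (functions (prod (ob D) (ob D)) (power (prod X Y)))).
intros F' ((F0 & F1 & ->) & Hob & Hhom & _).
apply mem_prod. do 2 eexists. split; [|split; [|reflexivity]].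
- apply mem_functions. exists F0. split; [|reflexivity].
  intros a Ha. rewrite <- (fobj_mk F0 F1 Ha). apply Hob, Ha.
- apply mem_functions. eexists. split; [|reflexivity].
  intros p Hp. apply mem_prod in Hp. destruct Hp as (a & b & Ha & Hb & ->).
  rewrite fst_pair, snd_pair. apply mem_power. intros q Hq.
  apply mem_fam in Hq. destruct Hq as (f & Hf & ->).
  apply mem_prod. exists f, (F1 a b f). split; [|split; [|reflexivity]].
  + apply mem_bigcup. exists a. split; [exact Ha|].
    apply mem_bigcup. exists b. auto.
  + specialize (Hhom a b f Ha Hb Hf). rewrite fmap_mk in Hhom by assumption.
    apply mem_bigcup. exists (fobj (mk_functor D F0 F1) a).
    split; [apply Hob, Ha|].
    apply mem_bigcup. exists (fobj (mk_functor D F0 F1) b). auto.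
Qed.

Lemma mem_nat_trans D E F G t :
  t \in nat_trans D E F G <-> is_nat_trans D E F G t.
Proof.
apply (mem_setof (P := is_nat_trans D E F G)).
destruct (bounded_fam (ob D)
  (bigcup (ob D) (fun a => hom E (fobj F a) (fobj G a)))) as [X HX].
exists X. intros u ((g & ->) & Hg & _). apply HX.
exists g. split; [|reflexivity]. intros a Ha.
apply mem_bigcup. exists a. split; [exact Ha|].
rewrite <- (app_fam g Ha). apply Hg, Ha.
Qed.

Definition functor_cat D E : category V.
Proof.
refine {| ob := functors D E;
          hom := nat_trans D E;
          idm := fun F => fam (ob D) (fun a => idm E (fobj F a));
          comp := fun F G H u t => fam (ob D) (fun a =>
            comp E (fobj F a) (fobj G a) (fobj H a) (app u a) (app t a)) |}.
- intros F HF. apply mem_functors in HF. destruct HF as (_ & F0 & F1 & _).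
  apply mem_nat_trans. split; [eexists; reflexivity|]. split.
  + intros x Hx. rewrite app_fam by exact Hx. apply idm_hom; auto.
  + intros x y f Hx Hy Hf. rewrite !app_fam by assumption.
    rewrite comp_idl, comp_idr; auto.
- intros F G H u t HF HG HH Hu Ht.
  apply mem_functors in HF. destruct HF as (_ & F0 & F1 & _).
  apply mem_functors in HG. destruct HG as (_ & G0 & G1 & _).
  apply mem_functors in HH. destruct HH as (_ & H0 & H1 & _).
  apply mem_nat_trans in Hu. destruct Hu as (_ & Hu & Nu).
  apply mem_nat_trans in Ht. destruct Ht as (_ & Ht & Nt).
  apply mem_nat_trans. split; [eexists; reflexivity|]. split.
  + intros x Hx. rewrite app_fam by exact Hx. apply comp_hom; auto.
  + intros x y f Hx Hy Hf. rewrite !app_fam by assumption.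
    rewrite <- comp_assoc by auto. rewrite Nt by assumption.
    rewrite comp_assoc by auto. rewrite Nu by assumption.
    symmetry. apply comp_assoc; auto.
- intros F G t HF HG Ht.
  apply mem_functors in HF. destruct HF as (_ & F0 & _ & _).
  apply mem_functors in HG. destruct HG as (_ & G0 & _ & _).
  apply mem_nat_trans in Ht. destruct Ht as ((g & ->) & Ht & _).
  apply fam_ext. intros x Hx. rewrite (app_fam (fun _ => idm _ _) Hx).
  rewrite comp_idl by auto. apply app_fam, Hx.
- intros F G t HF HG Ht.
  apply mem_functors in HF. destruct HF as (_ & F0 & _ & _).
  apply mem_functors in HG. destruct HG as (_ & G0 & _ & _).
  apply mem_nat_trans in Ht. destruct Ht as ((g & ->) & Ht & _).
  apply fam_ext. intros x Hx. rewrite (app_fam (fun _ => idm _ _) Hx).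
  rewrite comp_idr by auto. apply app_fam, Hx.
- intros F G H K v u t HF HG HH HK Hv Hu Ht.
  apply mem_functors in HF. destruct HF as (_ & F0 & _ & _).
  apply mem_functors in HG. destruct HG as (_ & G0 & _ & _).
  apply mem_functors in HH. destruct HH as (_ & H0 & _ & _).
  apply mem_functors in HK. destruct HK as (_ & K0 & _ & _).
  apply mem_nat_trans in Hv. destruct Hv as (_ & Hv & _).
  apply mem_nat_trans in Hu. destruct Hu as (_ & Hu & _).
  apply mem_nat_trans in Ht. destruct Ht as (_ & Ht & _).
  apply fam_ext. intros x Hx.
  rewrite !(app_fam (fun _ => comp _ _ _ _ _ _) Hx).
  apply comp_assoc; auto.
Defined.

Definition comp_functor D G F : V :=
  mk_functor D (fun a => fobj G (fobj F a))
    (fun a b f => fmap G (fobj F a) (fobj F b) (fmap F a b f)).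

Definition id_functor D : V := mk_functor D (fun a => a) (fun _ _ f => f).

(* The functor op D -> op E given by F : D -> E. *)
Definition op_functor D F : V :=
  mk_functor (op D) (fobj F) (fun a b f => fmap F b a f).

(* The functor prod_cat C D -> prod_cat C' D' given by F : C -> C' and
   G : D -> D'. *)
Definition prod_functor C D F G : V :=
  mk_functor (prod_cat C D)
    (fun p => pair (fobj F (fst p)) (fobj G (snd p)))
    (fun p q f => pair (fmap F (fst p) (fst q) (fst f))
                       (fmap G (snd p) (snd q) (snd f))).

(* The functor (F, G) |-> hom C F G on prod_cat (op C) C, which sends a
   morphism (t, u) : (F, G) -> (F', G') to s |-> u o s o t. *)
Definition hom_functor C : V :=
  mk_functor (prod_cat (op C) C)
    (fun p => hom C (fst p) (snd p))
    (fun p q tu => fam (hom C (fst p) (snd p)) (fun s =>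
       comp C (fst q) (snd p) (snd q) (snd tu)
         (comp C (fst q) (fst p) (snd p) s (fst tu)))).

(* The functor (a, F) |-> F a on prod_cat D (functor_cat D E), which sends a
   morphism (f, t) : (a, F) -> (b, G) to t_b o F f. *)
Definition app_functor D E : V :=
  mk_functor (prod_cat D (functor_cat D E))
    (fun p => fobj (snd p) (fst p))
    (fun p q ft =>
       comp E (fobj (snd p) (fst p)) (fobj (snd p) (fst q)) (fobj (snd q) (fst q))
         (app (snd ft) (fst q)) (fmap (snd p) (fst p) (fst q) (fst ft))).

Definition small_sets (U : V) : category V := set_cat U.

Definition class_cat (U : V) (k : nat) : category V := set_cat (classes U k).

Definition inclusion (U : V) : V := id_functor (small_sets U).

Definition presheaves (U : V) C : category V :=
  functor_cat (op C) (small_sets U).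

Definition yoneda_ob C (c : V) : V :=
  mk_functor (op C)
    (fun a => hom C a c)
    (fun a b f => fam (hom C a c) (fun g => comp C b a c g f)).

Definition yoneda C : V :=
  mk_functor C (yoneda_ob C)
    (fun c d f => fam (ob C) (fun a =>
       fam (hom C a c) (fun g => comp C a c d f g))).

(* For x in F c, the transformation from the Yoneda functor at c to F. *)
Definition beta_at C (c F x : V) : V :=
  fam (ob C) (fun a => fam (hom C a c) (fun f => app (fmap F c a f) x)).

Definition beta (U : V) C : V :=
  fam (prod (ob C) (ob (presheaves U C))) (fun p =>
    fam (fobj (snd p) (fst p)) (beta_at C (fst p) (snd p))).

End Categories.

(* Main.v *)
(* The inverse of beta sends s to s_c(id_c), as in the usual Yoneda lemma.  The
   set-theoretic point is that the homsets of [C^op, Set] are 2-classes: the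
   components of a natural transformation are small and its index set is a
   1-class, since Psi U = U.  This needs the least set Psi (power U) to exist,
   that is, some set must be closed under pairs and under families indexed by
   subsets of U.  Such a set is obtained in stages indexed by well-founded trees
   of paths in U: as U is closed under pairing, grafting any family of trees
   indexed by a subset of U onto a common root gives such a tree again, so that
   every family of stages is bounded by a stage. *)
Require Import Defs.
From Stdlib Require Import ClassicalEpsilon.
Local Open Scope zfc_scope.

(** * Functions as families, and predicates bounded by a set *)

Section FunctionSets.
Context {V : zfc}.
Implicit Types (A B I X Y f g p x y : V).

Lemma functions_app A B f x :
  f \in functions A B -> x \in A -> app f x \in B.
Proof.
intros Hf Hx. apply mem_functions in Hf. destruct Hf as (g & Hg & ->).
rewrite app_fam by exact Hx. auto.
Qed.

Lemma fam_functions A B (g : V -> V) :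
  (forall x, x \in A -> g x \in B) -> fam A g \in functions A B.
Proof. intros Hg. apply mem_functions. exists g. auto. Qed.

Lemma fam_app I (g : V -> V) : fam I (app (fam I g)) = fam I g.
Proof. apply fam_ext. intros i Hi. apply app_fam, Hi. Qed.

Lemma functions_fam A B f : f \in functions A B -> fam A (app f) = f.
Proof.
intros Hf. apply mem_functions in Hf. destruct Hf as (g & _ & ->).
apply fam_app.
Qed.

(** The codomains may differ, since a function is just the family of its values. *)
Lemma functions_ext A B B' f g :
  f \in functions A B -> g \in functions A B' ->
  (forall x, x \in A -> app f x = app g x) -> f = g.
Proof.
intros Hf Hg E. rewrite <- (functions_fam _ _ _ Hf), <- (functions_fam _ _ _ Hg).
apply fam_ext, E.
Qed.

Lemma mem_prod_pair A B x y : x \in A -> y \in B -> pair x y \in prod A B.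
Proof. intros Hx Hy. apply mem_prod. exists x, y. auto. Qed.

(** Keeps the empty path, which codes the root of a tree, apart from all longer paths. *)
Lemma pair_neq_empty x y : pair x y <> empty.
Proof.
intros E. apply (mem_empty (x := upair x x)). rewrite <- E.
apply mem_upair. auto.
Qed.

Lemma bounded_mem X : bounded (fun x => x \in X).
Proof. exists X. auto. Qed.

Lemma bounded_or (P Q : V -> Prop) :
  bounded P -> bounded Q -> bounded (fun x => P x \/ Q x).
Proof.
intros [X HX] [Y HY]. exists (bigcup (upair X Y) (fun z => z)).
intros x Hx. apply mem_bigcup.
destruct Hx; [exists X|exists Y]; rewrite mem_upair; auto.
Qed.

(** Boundedness turns the index predicate and each fibre into sets, and replacement with union then
    bounds the whole family. *)
Lemma bounded_union_family (R : V -> Prop) (P : V -> V -> Prop) :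
  bounded R -> (forall s, R s -> bounded (P s)) ->
  bounded (fun x => exists s, R s /\ P s x).
Proof.
intros HR HP. exists (bigcup (setof R) (fun s => setof (P s))).
intros x (s & Hs & Hx). apply mem_bigcup. exists s.
rewrite !mem_setof; auto.
Qed.

End FunctionSets.

(** * Closure properties of a universe, existence of [Psi], and 2-classes *)

Section Universes.
Context {V : zfc} (U : V).
Hypothesis HU : universe U.
Implicit Types (A B I X Y f g p x y : V).

Lemma universe_subset x : x \in U -> subset x U.
Proof. apply HU. Qed.

Lemma universe_pair x y : x \in U -> y \in U -> pair x y \in U.
Proof.
destruct HU as (_ & _ & Hp & _). intros Hx Hy. unfold pair. auto.
Qed.

(** A family is the union over its index set of the singletons of its pairs; the indices are small
    because a small set is a subset of [U]. *)
Lemma universe_fam I (g : V -> V) :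
  I \in U -> (forall i, i \in I -> g i \in U) -> fam I g \in U.
Proof.
intros HI Hg.
replace (fam I g)
  with (bigcup I (fun i => upair (pair i (g i)) (pair i (g i)))).
- destruct HU as (Ht & _ & Hp & Hb & _). apply Hb; [exact HI|].
  intros i Hi. assert (pair i (g i) \in U); [|auto].
  apply universe_pair; [|auto]. apply (Ht I HI _ Hi).
- apply zfc_ext. intros p. rewrite mem_bigcup, mem_fam.
  split; intros (i & Hi & Hp); exists i; rewrite mem_upair in *; tauto.
Qed.

Lemma Psi_closed_universe : Psi_closed U U U.
Proof.
split; [auto|]. split; [auto|]. split; [exact universe_pair|].
exact universe_fam.
Qed.

(** [U] is itself closed under the four clauses, and the first clause puts [U] inside every closed
    set. *)
Lemma Psi_universe : Psi U U = U.
Proof.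
apply the_eq.
- split; [exact Psi_closed_universe|]. intros Q (HQ & _). exact HQ.
- intros P ((HP & _) & Hmin). apply zfc_ext. intros x.
  split; [|apply HP]. apply Hmin. exact Psi_closed_universe.
Qed.

(* A subset [t] of [U] containing the empty set is read as a tree: the path
   i_1, ..., i_n is coded by (i_1, (..., (i_n, 0))), which lies in [U].
   [subtree s t] says that [s] hangs immediately below the root of [t]. *)
Definition subtree (s t : V) : Prop :=
  empty \in s /\ subset s U /\
  exists i, i \in U /\ forall x, x \in s <-> pair i x \in t.

Definition tree (t : V) : Prop :=
  empty \in t /\ subset t U /\ Acc subtree t.

(** The tree with [s i] hanging at position [i] below a new root, for each [i] in [I]. *)
Definition graft I (s : V -> V) : V :=
  setof (fun z => z = empty \/ exists i x, i \in I /\ x \in s i /\ z = pair i x).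

Lemma mem_graft I (s : V -> V) z :
  z \in graft I s <->
  z = empty \/ exists i x, i \in I /\ x \in s i /\ z = pair i x.
Proof.
apply (mem_setof (P := fun z => z = empty \/
  exists i x, i \in I /\ x \in s i /\ z = pair i x)).
set (X := bigcup I (fun i => prod I (s i))).
exists (bigcup (upair (upair empty empty) X) (fun y => y)).
intros t Ht. apply mem_bigcup. destruct Ht as [->|(i & x & Hi & Hx & ->)].
- exists (upair empty empty). rewrite !mem_upair. auto.
- exists X. rewrite mem_upair. split; [auto|].
  apply mem_bigcup. exists i. split; [exact Hi|]. apply mem_prod_pair; auto.
Qed.

Lemma mem_graft_pair I (s : V -> V) i x :
  pair i x \in graft I s <-> i \in I /\ x \in s i.
Proof.
rewrite mem_graft. split.
- intros [E|(j & y & Hj & Hy & E)]; [destruct (pair_neq_empty _ _ E)|].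
  apply pair_inj in E. destruct E as [-> ->]. auto.
- intros [Hi Hx]. right. exists i, x. auto.
Qed.

Lemma subtree_graft I (s : V -> V) i :
  subset I U -> (forall i, i \in I -> tree (s i)) -> i \in I ->
  subtree (s i) (graft I s).
Proof.
intros HI Hs Hi. destruct (Hs i Hi) as (H0 & H1 & _).
split; [exact H0|]. split; [exact H1|]. exists i. split; [auto|].
intros x. rewrite mem_graft_pair. tauto.
Qed.

(** Well-foundedness is inherited because the grafted trees are the only subtrees: a subtree
    contains the empty path, which forces its position [i] into [I], and its paths are then exactly
    those of [s i]. *)
Lemma tree_graft I (s : V -> V) :
  subset I U -> (forall i, i \in I -> tree (s i)) -> tree (graft I s).
Proof.
intros HI Hs. split; [apply mem_graft; auto|]. split.
- intros z Hz. apply mem_graft in Hz. destruct Hz as [->|(i & x & Hi & Hx & ->)].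
  + apply HU.
  + apply universe_pair; [auto|]. apply (Hs i Hi), Hx.
- constructor. intros r (H0 & _ & i & _ & Hr).
  assert (Hi : i \in I) by (apply Hr, mem_graft_pair in H0; apply H0).
  replace r with (s i); [apply (Hs i Hi)|].
  apply zfc_ext. intros x. rewrite Hr, mem_graft_pair. tauto.
Qed.

(* [built A t x]: [x] is generated by the clauses of [Psi U A] along [t]. *)
Inductive built A (t : V) : V -> Prop :=
| built_small x : x \in U -> built A t x
| built_index I : I \in A -> built A t I
| built_pair r s x y : subtree r t -> subtree s t ->
    built A r x -> built A s y -> built A t (pair x y)
| built_fam I (s x : V -> V) : I \in A ->
    (forall i, i \in I -> subtree (s i) t) ->
    (forall i, i \in I -> built A (s i) (x i)) -> built A t (fam I x).

(** Induction on the tree: its subtrees are subsets of [U], so the earlier stages have a common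
    bound [Y]. The new elements lie in [U], in [A], in the product of [Y] with itself, or among the
    functions from a member of [A] to [Y]. *)
Lemma bounded_built A t : Acc subtree t -> bounded (built A t).
Proof.
induction 1 as [t _ IH].
assert (Ht : bounded (fun s => subtree s t)).
{ exists (power U). intros s (_ & Hs & _). apply mem_power, Hs. }
destruct (bounded_union_family _ (built A) Ht IH) as [Y HY].
destruct (bounded_or _ _ (bounded_mem U) (bounded_or _ _ (bounded_mem A)
  (bounded_or _ _ (bounded_mem (prod Y Y))
     (bounded_mem (bigcup A (fun I => functions I Y))))))
  as [X HX].
exists X. intros x Hx. apply HX.
destruct Hx as [x Hx|I HI|r s x y Hr Hs Hx Hy|I s x HI Hs Hx].
- auto.
- auto.
- do 2 right. left. apply mem_prod_pair; apply HY; eauto.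
- do 3 right. apply mem_bigcup. exists I. split; [exact HI|].
  apply fam_functions. intros i Hi. apply HY. eauto.
Qed.

(** The union of the stages over all trees is closed. It is a set because trees are subsets of [U]
    and each stage is bounded. *)
Lemma Psi_closed_exists A : subset A (power U) -> exists P, Psi_closed U A P.
Proof.
intros HA.
set (P := fun x => exists t, tree t /\ built A t x).
assert (HP : forall x, x \in setof P <-> P x).
{ apply mem_setof. apply bounded_union_family.
  - exists (power U). intros t (_ & Ht & _). apply mem_power, Ht.
  - intros t (_ & _ & Ht). apply bounded_built, Ht. }
(* The first two clauses use no subtree, so any tree serves them; the bare root is one. *)
assert (H0 : tree (graft empty (fun x => x))).
{ apply tree_graft; intros i Hi; destruct (mem_empty Hi). }
(* One tree is chosen per component, and the chosen trees are grafted onto a common root. Positions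
   below a root are elements of [U], hence the condition on [I]. *)
assert (Hfam : forall I (x : V -> V), subset I U ->
  (forall i, i \in I -> P (x i)) ->
  exists s : V -> V, tree (graft I s) /\
    forall i, i \in I -> subtree (s i) (graft I s) /\ built A (s i) (x i)).
{ intros I x HI Hx.
  set (s := fun i => epsilon (inhabits i) (fun t => tree t /\ built A t (x i))).
  assert (Hs : forall i, i \in I -> tree (s i) /\ built A (s i) (x i)).
  { intros i Hi. apply (epsilon_spec (inhabits i)
      (fun t => tree t /\ built A t (x i))). apply Hx, Hi. }
  exists s. split; [apply tree_graft; [exact HI|apply Hs]|].
  intros i Hi. split; [|apply Hs, Hi].
  apply subtree_graft; [exact HI|apply Hs|exact Hi]. }
exists (setof P). split; [|split; [|split]].
- intros x Hx. apply HP. eexists. split; [exact H0|]. constructor 1. exact Hx.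
- intros I HI. apply HP. eexists. split; [exact H0|]. constructor 2. exact HI.
- intros x y Hx Hy. apply HP in Hx, Hy. apply HP.
  (* A pair is treated as a family over the two indices 0 and {0}, which lie in every universe, so
     that [Hfam] covers this clause too. *)
  set (one := upair empty empty : V).
  set (z := fun i : V => if excluded_middle_informative (i = empty) then x else y).
  destruct (Hfam (upair empty one) z) as (s & Ht & Hs).
  + destruct HU as (_ & He & Hu & _). intros i Hi.
    apply mem_upair in Hi. destruct Hi as [->| ->]; unfold one; auto.
  + intros i _. unfold z. destruct excluded_middle_informative; assumption.
  + exists (graft (upair empty one) s). split; [exact Ht|].
    destruct (Hs empty) as [A1 A2]; [apply mem_upair; auto|].
    destruct (Hs one) as [B1 B2]; [apply mem_upair; auto|].
    unfold z in A2, B2. destruct excluded_middle_informative as [_|N] in A2;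
      [|destruct N; reflexivity].
    destruct excluded_middle_informative as [E|_] in B2.
    (* The two indices are distinct, as [one] has an element. *)
    * destruct (mem_empty (V := V) (x := empty)). rewrite <- E at 2. apply mem_upair. auto.
    * exact (built_pair _ _ _ _ _ _ A1 B1 A2 B2).
- intros I x HI Hx. apply HP.
  destruct (Hfam I x) as (s & Ht & Hs).
  + apply mem_power, HA, HI.
  + intros i Hi. apply HP. auto.
  + exists (graft I s). split; [exact Ht|].
    apply (built_fam A _ I s x HI); intros i Hi; apply Hs, Hi.
Qed.

(** The intersection of all closed sets is the least one, and it is a set because some closed set
    exists to bound it. The description that defines [Psi U A] is therefore satisfied. *)
Lemma Psi_closed_Psi A : subset A (power U) -> Psi_closed U A (Psi U A).
Proof.
intros HA. destruct (Psi_closed_exists A HA) as [X HX].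
set (P := fun x => forall Q, Psi_closed U A Q -> x \in Q).
assert (HP : forall x, x \in setof P <-> P x).
{ apply mem_setof. exists X. intros x Hx. apply Hx, HX. }
apply (epsilon_spec zfc_inhabited
  (fun P => Psi_closed U A P /\ forall Q, Psi_closed U A Q -> subset P Q)).
exists (setof P). split.
- split; [|split; [|split]].
  + intros x Hx. apply HP. intros Q (HQ & _). auto.
  + intros I HI. apply HP. intros Q (_ & HQ & _). auto.
  + intros x y Hx Hy. apply HP in Hx, Hy. apply HP. intros Q HQ.
    apply (proj1 (proj2 (proj2 HQ))); auto.
  + intros I x HI Hx. apply HP. intros Q HQ.
    apply (proj2 (proj2 (proj2 HQ))); [exact HI|].
    intros i Hi. specialize (Hx i Hi). apply HP in Hx. auto.
- intros Q HQ x Hx. apply HP in Hx. apply Hx, HQ.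
Qed.

(** By [Psi_universe], the 1-classes are exactly the subsets of [U]. *)
Lemma mem_classes2 X : X \in classes U 2 <-> subset X (Psi U (power U)).
Proof.
unfold classes. cbn [Nat.iter nat_rect]. rewrite Psi_universe. apply mem_power.
Qed.

Lemma universe_subset_classes2 : subset U (classes U 2).
Proof.
intros X HX. apply mem_classes2. intros x Hx.
apply (proj1 (Psi_closed_Psi _ (fun I HI => HI))).
exact (universe_subset X HX x Hx).
Qed.

End Universes.

(** * Functoriality of the general constructions *)

Section Functors.
Context {V : zfc}.
Implicit Types (C D E : category V) (F G H X Y : V).

(** Reduces the functor laws for a set-theoretic pair of families to laws for [F0] and [F1]. *)
Lemma mk_functor_is_functor D E (F0 : V -> V) (F1 : V -> V -> V -> V) :
  (forall a, a \in ob D -> F0 a \in ob E) ->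
  (forall a b f, a \in ob D -> b \in ob D -> f \in hom D a b ->
     F1 a b f \in hom E (F0 a) (F0 b)) ->
  (forall a, a \in ob D -> F1 a a (idm D a) = idm E (F0 a)) ->
  (forall a b c g f, a \in ob D -> b \in ob D -> c \in ob D ->
     g \in hom D b c -> f \in hom D a b ->
     F1 a c (comp D a b c g f) =
     comp E (F0 a) (F0 b) (F0 c) (F1 b c g) (F1 a b f)) ->
  is_functor D E (mk_functor D F0 F1).
Proof.
intros H0 H1 Hi Hc. split; [exists F0, F1; reflexivity|].
split; [|split; [|split]]; intros.
- rewrite fobj_mk; auto.
- rewrite !fobj_mk, fmap_mk; auto.
- rewrite fobj_mk, fmap_mk; auto using idm_hom.
- rewrite !fobj_mk, !fmap_mk; auto. apply (comp_hom (b := b)); auto.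
Qed.

Lemma functor_ob D E F a : is_functor D E F -> a \in ob D -> fobj F a \in ob E.
Proof. intros HF. apply HF. Qed.

Lemma functor_hom D E F a b f : is_functor D E F ->
  a \in ob D -> b \in ob D -> f \in hom D a b ->
  fmap F a b f \in hom E (fobj F a) (fobj F b).
Proof. intros HF. apply HF. Qed.

Lemma functor_idm D E F a : is_functor D E F -> a \in ob D ->
  fmap F a a (idm D a) = idm E (fobj F a).
Proof. intros HF. apply HF. Qed.

Lemma functor_comp D E F a b c g f : is_functor D E F ->
  a \in ob D -> b \in ob D -> c \in ob D ->
  g \in hom D b c -> f \in hom D a b ->
  fmap F a c (comp D a b c g f) =
  comp E (fobj F a) (fobj F b) (fobj F c) (fmap F b c g) (fmap F a b f).
Proof. intros HF. apply HF. Qed.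

Hint Resolve functor_ob functor_hom comp_hom idm_hom : core.

Lemma comp_functor_is_functor D E E' G F :
  is_functor D E F -> is_functor E E' G -> is_functor D E' (comp_functor D G F).
Proof.
intros HF HG. apply mk_functor_is_functor; intros; eauto.
- rewrite (functor_idm D E F), (functor_idm E E' G); eauto.
- rewrite (functor_comp D E F a b c), <- (functor_comp E E' G); eauto.
Qed.

Lemma op_functor_is_functor D E F :
  is_functor D E F -> is_functor (op D) (op E) (op_functor D F).
Proof.
intros HF. apply mk_functor_is_functor; cbn [ob hom idm comp op]; intros; eauto.
- apply functor_idm; assumption.
- apply functor_comp with (D := D); assumption.
Qed.

Ltac unpair :=
  cbn [ob hom idm comp prod_cat] in *;
  repeat match goal with
  | H : mem _ (prod _ _) |- _ =>
      apply mem_prod in H; destruct H as (? & ? & ? & ? & ->)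
  end; rewrite ?fst_pair, ?snd_pair in *.

Lemma prod_functor_is_functor C D C' D' F G :
  is_functor C C' F -> is_functor D D' G ->
  is_functor (prod_cat C D) (prod_cat C' D') (prod_functor C D F G).
Proof.
intros HF HG. apply mk_functor_is_functor; intros; unpair; unpair.
- apply mem_prod_pair; eauto.
- apply mem_prod_pair; eauto.
- rewrite (functor_idm C C'), (functor_idm D D'); auto.
- rewrite (functor_comp C C'), (functor_comp D D'); auto.
Qed.

Lemma id_functor_is_functor D : is_functor D D (id_functor D).
Proof. apply mk_functor_is_functor; auto. Qed.

(** The homsets, identities and composites of [set_cat X] do not depend on [X], so only the objects
    have to be compared. *)
Lemma set_inclusion_is_functor X Y :
  subset X Y -> is_functor (set_cat X) (set_cat Y) (id_functor (set_cat X)).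
Proof. intros HXY. apply mk_functor_is_functor; auto. Qed.

Lemma hom_functor_is_functor C X :
  (forall a b, a \in ob C -> b \in ob C -> hom C a b \in X) ->
  is_functor (prod_cat (op C) C) (set_cat X) (hom_functor C).
Proof.
intros HX. apply mk_functor_is_functor; intros; unpair; unpair;
  cbn [ob hom idm comp op set_cat] in *.
- auto.
- apply fam_functions. eauto.
- apply fam_ext. intros s Hs. rewrite comp_idl, comp_idr; auto.
- apply fam_ext. intros s Hs. rewrite !(app_fam _ Hs), app_fam by eauto.
  rewrite !comp_assoc by eauto. reflexivity.
Qed.

Lemma app_functor_is_functor D E :
  is_functor (prod_cat D (functor_cat D E)) E (app_functor D E).
Proof.
apply mk_functor_is_functor.
- intros p Hp. unpair.
  match goal with H : _ \in ob (functor_cat D E) |- _ =>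
    apply mem_functors in H end.
  eauto.
- intros p q f Hp Hq Hf. unpair. unpair.
  match goal with H : _ \in hom (functor_cat D E) _ _ |- _ =>
    apply mem_nat_trans in H; destruct H as (_ & Ht & _) end.
  repeat match goal with H : _ \in ob (functor_cat D E) |- _ =>
    apply mem_functors in H end.
  apply comp_hom; eauto.
- intros p Hp. unpair.
  match goal with H : _ \in ob (functor_cat D E) |- _ =>
    apply mem_functors in H end.
  cbn [idm functor_cat]. rewrite app_fam by assumption.
  rewrite (functor_idm D E) by assumption. apply comp_idl; eauto.
- intros p q r g f Hp Hq Hr Hg Hf.
  apply mem_prod in Hp, Hq, Hr.
  destruct Hp as (a & F & Ha & HF & ->), Hq as (b & G & Hb & HG & ->),
    Hr as (c & H & Hc & HH & ->).
  apply mem_prod in Hg, Hf.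
  destruct Hg as (k & u & Hk & Hu & ->), Hf as (h & t & Hh & Ht & ->).
  cbn [comp prod_cat functor_cat]. rewrite !fst_pair, !snd_pair in *.
  apply mem_functors in HF, HG, HH. apply mem_nat_trans in Hu, Ht.
  destruct Hu as (_ & Hu & _), Ht as (_ & Ht & Nt).
  rewrite app_fam by assumption. rewrite (functor_comp D E) by assumption.
  assert (Fk := functor_hom _ _ _ _ _ _ HF Hb Hc Hk).
  assert (Fh := functor_hom _ _ _ _ _ _ HF Ha Hb Hh).
  assert (Gk := functor_hom _ _ _ _ _ _ HG Hb Hc Hk).
  assert (tb := Ht b Hb). assert (tc := Ht c Hc). assert (uc := Hu c Hc).
  (* Reassociation brings [app t c] next to the action of [F] on [k]; naturality of [t] exchanges it
     for the action of [G] on [k] after [app t b]. *)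
  rewrite <- (comp_assoc (c := fobj G c) (g := app t c)) by eauto.
  rewrite (comp_assoc (h := app t c)) by eauto.
  rewrite Nt by assumption.
  rewrite <- (comp_assoc (f := fmap F a b h)) by eauto.
  apply comp_assoc; eauto.
Qed.

(** * Set-valued functors and their transformations, element by element *)

Section SetValued.
Context {D : category V} {X : V}.

Lemma set_functor_idm F a x : is_functor D (set_cat X) F ->
  a \in ob D -> x \in fobj F a -> app (fmap F a a (idm D a)) x = x.
Proof.
intros HF Ha Hx. rewrite (functor_idm _ _ _ _ HF Ha). exact (app_fam _ Hx).
Qed.

Lemma set_functor_comp F a b c g f x : is_functor D (set_cat X) F ->
  a \in ob D -> b \in ob D -> c \in ob D ->
  g \in hom D b c -> f \in hom D a b -> x \in fobj F a ->
  app (fmap F a c (comp D a b c g f)) x =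
  app (fmap F b c g) (app (fmap F a b f) x).
Proof.
intros HF Ha Hb Hc Hg Hf Hx.
rewrite (functor_comp _ _ _ _ _ _ _ _ HF Ha Hb Hc Hg Hf). exact (app_fam _ Hx).
Qed.

Lemma set_functor_app F a b f x : is_functor D (set_cat X) F ->
  a \in ob D -> b \in ob D -> f \in hom D a b -> x \in fobj F a ->
  app (fmap F a b f) x \in fobj F b.
Proof.
intros HF Ha Hb Hf. apply functions_app.
apply (functor_hom _ _ _ _ _ _ HF Ha Hb Hf).
Qed.

Lemma set_nat_trans_app F G t a x : t \in nat_trans D (set_cat X) F G ->
  a \in ob D -> x \in fobj F a -> app (app t a) x \in fobj G a.
Proof.
intros Ht Ha. apply mem_nat_trans in Ht. apply functions_app. apply Ht, Ha.
Qed.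

Lemma set_nat_trans_natural F G t a b f x :
  t \in nat_trans D (set_cat X) F G ->
  a \in ob D -> b \in ob D -> f \in hom D a b -> x \in fobj F a ->
  app (app t b) (app (fmap F a b f) x) = app (fmap G a b f) (app (app t a) x).
Proof.
intros Ht Ha Hb Hf Hx. apply mem_nat_trans in Ht. destruct Ht as (_ & _ & Nt).
specialize (Nt a b f Ha Hb Hf). cbn [comp set_cat] in Nt.
apply (f_equal (fun h => app h x)) in Nt. rewrite !app_fam in Nt; auto.
Qed.

Lemma set_nat_trans_ext F G t u :
  t \in nat_trans D (set_cat X) F G -> u \in nat_trans D (set_cat X) F G ->
  (forall a x, a \in ob D -> x \in fobj F a ->
     app (app t a) x = app (app u a) x) -> t = u.
Proof.
intros Ht Hu E. apply mem_nat_trans in Ht, Hu.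
destruct Ht as ((g & ->) & Ht & _), Hu as ((h & ->) & Hu & _).
(* Each family is rewritten through its own components, which are what the hypotheses speak
   about. *)
rewrite <- (fam_app _ g), <- (fam_app _ h). apply fam_ext. intros a Ha.
apply (functions_ext (fobj F a) (fobj G a) (fobj G a)); auto.
Qed.

Lemma set_nat_trans_intro F G (t : V -> V -> V) :
  (forall a x, a \in ob D -> x \in fobj F a -> t a x \in fobj G a) ->
  (forall a b f, a \in ob D -> b \in ob D -> f \in hom D a b ->
     fmap F a b f \in functions (fobj F a) (fobj F b)) ->
  (forall a b f x, a \in ob D -> b \in ob D -> f \in hom D a b ->
     x \in fobj F a ->
     t b (app (fmap F a b f) x) = app (fmap G a b f) (t a x)) ->
  fam (ob D) (fun a => fam (fobj F a) (t a)) \in nat_trans D (set_cat X) F G.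
Proof.
intros Ht HF Nt. apply mem_nat_trans. split; [eexists; reflexivity|]. split.
- intros a Ha. rewrite app_fam by exact Ha. apply fam_functions. auto.
- intros a b f Ha Hb Hf. cbn [comp set_cat]. apply fam_ext. intros x Hx.
  rewrite (app_fam _ Ha), (app_fam _ Hb), (app_fam _ Hx).
  rewrite app_fam; [auto|]. apply (functions_app (fobj F a)); auto.
Qed.

End SetValued.
End Functors.

(** * The Yoneda functor, and the Yoneda lemma at a fixed object and presheaf *)

Section Yoneda.
Context {V : zfc} (U : V) (C : category V).
Hypothesis HC : light U C.
Implicit Types (F G a b c f g p q s x : V).

Lemma yoneda_ob_is_functor c :
  c \in ob C -> is_functor (op C) (set_cat U) (yoneda_ob C c).
Proof.
intros Hc. apply mk_functor_is_functor; cbn [ob hom idm comp op set_cat].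
- intros a Ha. apply HC; assumption.
- intros a b f Ha Hb Hf. apply fam_functions. intros g Hg.
  apply (comp_hom (b := a)); assumption.
- intros a Ha. apply fam_ext. intros g Hg. apply comp_idr; assumption.
- intros a b d g f Ha Hb Hd Hg Hf. apply fam_ext. intros h Hh.
  rewrite (app_fam _ Hh), app_fam by (apply (comp_hom (b := a)); assumption).
  apply comp_assoc; assumption.
Qed.

Lemma fobj_yoneda_ob c a : a \in ob C -> fobj (yoneda_ob C c) a = hom C a c.
Proof. exact (fobj_mk (D := op C) _ _ (a := a)). Qed.

Lemma app_fmap_yoneda_ob c a b f g :
  a \in ob C -> b \in ob C -> f \in hom C b a -> g \in hom C a c ->
  app (fmap (yoneda_ob C c) a b f) g = comp C b a c g f.
Proof.
intros Ha Hb Hf Hg. unfold yoneda_ob.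
rewrite fmap_mk by assumption. exact (app_fam _ Hg).
Qed.

Lemma yoneda_nat_trans_intro c F (t : V -> V -> V) :
  c \in ob C ->
  (forall a f, a \in ob C -> f \in hom C a c -> t a f \in fobj F a) ->
  (forall a b f g, a \in ob C -> b \in ob C -> f \in hom C b a ->
     g \in hom C a c ->
     t b (comp C b a c g f) = app (fmap F a b f) (t a g)) ->
  fam (ob C) (fun a => fam (hom C a c) (t a))
    \in nat_trans (op C) (set_cat U) (yoneda_ob C c) F.
Proof.
intros Hc Ht Nt.
(* Over objects of [C] the homset is the value of the representable presheaf, which is the domain
   expected by [set_nat_trans_intro]. *)
rewrite (fam_ext (h := fun a => fam (fobj (yoneda_ob C c) a) (t a)))
  by (intros a Ha; rewrite fobj_yoneda_ob by exact Ha; reflexivity).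
apply (set_nat_trans_intro (D := op C)).
- intros a f Ha Hf. rewrite fobj_yoneda_ob in Hf by exact Ha. auto.
- apply (yoneda_ob_is_functor c Hc).
- intros a b f g Ha Hb Hf Hg. rewrite fobj_yoneda_ob in Hg by exact Ha.
  rewrite app_fmap_yoneda_ob by assumption. auto.
Qed.

(** Associativity in [C] gives both the naturality of postcomposition and the preservation of
    composites. *)
Lemma yoneda_is_functor : is_functor C (presheaves U C) (yoneda C).
Proof.
apply mk_functor_is_functor.
- intros c Hc. apply mem_functors, yoneda_ob_is_functor, Hc.
- intros c d f Hc Hd Hf. apply yoneda_nat_trans_intro; [exact Hc| |].
  + intros a g Ha Hg. rewrite fobj_yoneda_ob by exact Ha.
    apply (comp_hom (b := c)); assumption.
  + intros a b h g Ha Hb Hh Hg.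
    rewrite app_fmap_yoneda_ob
      by (try assumption; apply (comp_hom (b := c)); assumption).
    apply comp_assoc; assumption.
- intros c Hc. apply fam_ext. intros a Ha.
  rewrite fobj_yoneda_ob by exact Ha. apply fam_ext. intros g Hg.
  apply comp_idl; assumption.
- intros c d e g f Hc Hd He Hg Hf. apply fam_ext. intros a Ha.
  rewrite !(app_fam _ Ha), fobj_yoneda_ob by exact Ha.
  apply fam_ext. intros h Hh.
  rewrite (app_fam _ Hh), app_fam by (apply (comp_hom (b := c)); assumption).
  symmetry. apply comp_assoc; assumption.
Qed.

Lemma app_beta_at c F x a f : a \in ob C -> f \in hom C a c ->
  app (app (beta_at C c F x) a) f = app (fmap F c a f) x.
Proof.
intros Ha Hf. unfold beta_at. rewrite (app_fam _ Ha). exact (app_fam _ Hf).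
Qed.

(** Naturality is the preservation of composites by [F], evaluated at [x]. *)
Lemma beta_at_nat_trans c F x :
  c \in ob C -> is_functor (op C) (set_cat U) F -> x \in fobj F c ->
  beta_at C c F x \in nat_trans (op C) (set_cat U) (yoneda_ob C c) F.
Proof.
intros Hc HF Hx. apply yoneda_nat_trans_intro; [exact Hc| |].
- intros a f Ha Hf. apply (set_functor_app F c a f x HF); assumption.
- intros a b f g Ha Hb Hf Hg.
  apply (set_functor_comp F c a b f g x HF); assumption.
Qed.

Lemma beta_at_idm c F x :
  c \in ob C -> is_functor (op C) (set_cat U) F -> x \in fobj F c ->
  app (app (beta_at C c F x) c) (idm C c) = x.
Proof.
intros Hc HF Hx. rewrite app_beta_at by auto using idm_hom.
apply (set_functor_idm F c x HF); assumption.
Qed.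

Lemma nat_trans_yoneda_idm c F s :
  c \in ob C -> s \in nat_trans (op C) (set_cat U) (yoneda_ob C c) F ->
  app (app s c) (idm C c) \in fobj F c.
Proof.
intros Hc Hs. apply (set_nat_trans_app _ _ _ _ _ Hs Hc).
rewrite fobj_yoneda_ob by exact Hc. apply idm_hom, Hc.
Qed.

(** Naturality of [s] along [f], applied to the identity of [c], shows that [f] acts on the value of
    [s] at the identity by giving the value of [s] at [f]. *)
Lemma beta_at_yoneda c F s :
  c \in ob C -> is_functor (op C) (set_cat U) F ->
  s \in nat_trans (op C) (set_cat U) (yoneda_ob C c) F ->
  beta_at C c F (app (app s c) (idm C c)) = s.
Proof.
intros Hc HF Hs.
assert (Hx := nat_trans_yoneda_idm c F s Hc Hs).
apply (set_nat_trans_ext _ _ _ _ (beta_at_nat_trans c F _ Hc HF Hx) Hs).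
intros a f Ha Hf. rewrite fobj_yoneda_ob in Hf by exact Ha.
rewrite app_beta_at by assumption.
assert (Hi := idm_hom Hc).
rewrite <- (set_nat_trans_natural (D := op C) _ _ _ c a f _ Hs);
  [|assumption|assumption|assumption|rewrite fobj_yoneda_ob; assumption].
rewrite app_fmap_yoneda_ob by assumption.
f_equal. apply comp_idl; assumption.
Qed.

End Yoneda.

(** * Size of the presheaf homsets, the two composite functors, and [beta] *)

Section Proposition.
Context {V : zfc} (U : V) (C : category V).
Hypothesis HU : universe U.
Hypothesis HC : light U C.

(** A transformation is a family over [ob C], a subset of [U], hence an index set allowed by
    [Psi U (power U)]. Each component is a function between small sets and so is small. *)
Lemma nat_trans_classes2 F G :
  is_functor (op C) (set_cat U) F -> is_functor (op C) (set_cat U) G ->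
  nat_trans (op C) (set_cat U) F G \in classes U 2.
Proof.
intros HF HG. apply (mem_classes2 _ HU). intros t Ht.
destruct (Psi_closed_Psi _ HU _ (fun I (HI : I \in power U) => HI))
  as (Hsmall & _ & _ & Hfam).
apply mem_nat_trans in Ht. destruct Ht as ((g & ->) & Ht & _).
apply Hfam; [apply mem_power, HC|].
intros a Ha. apply Hsmall. specialize (Ht a Ha).
rewrite app_fam in Ht by exact Ha.
apply mem_functions in Ht. destruct Ht as (h & Hh & ->).
assert (HFa : fobj F a \in U) by apply (functor_ob _ _ _ _ HF Ha).
assert (HGa : fobj G a \in U) by apply (functor_ob _ _ _ _ HG Ha).
apply (universe_fam _ HU); [exact HFa|].
intros x Hx. exact (universe_subset _ HU _ HGa _ (Hh x Hx)).
Qed.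

Lemma hom_presheaves_classes2 F G :
  F \in ob (presheaves U C) -> G \in ob (presheaves U C) ->
  hom (presheaves U C) F G \in classes U 2.
Proof.
intros HF HG. apply mem_functors in HF, HG. apply nat_trans_classes2; assumption.
Qed.

Let PSh := presheaves U C.
Let D := prod_cat (op C) PSh.
Let eval := comp_functor D (inclusion U) (app_functor (op C) (small_sets U)).
Let Yid := prod_functor (op C) PSh (op_functor C (yoneda C)) (id_functor PSh).
Let hom_yoneda := comp_functor D (hom_functor PSh) Yid.

Lemma yoneda_id_is_functor :
  is_functor D (prod_cat (op PSh) PSh) Yid.
Proof.
apply prod_functor_is_functor; [|apply id_functor_is_functor].
apply op_functor_is_functor, yoneda_is_functor, HC.
Qed.

Lemma eval_is_functor : is_functor D (class_cat U 2) eval.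
Proof.
apply (comp_functor_is_functor _ (small_sets U)).
- apply app_functor_is_functor.
- apply set_inclusion_is_functor, universe_subset_classes2, HU.
Qed.

Lemma hom_yoneda_is_functor : is_functor D (class_cat U 2) hom_yoneda.
Proof.
apply (comp_functor_is_functor _ (prod_cat (op PSh) PSh)).
- exact yoneda_id_is_functor.
- apply hom_functor_is_functor, hom_presheaves_classes2.
Qed.

Lemma fobj_eval c F :
  c \in ob C -> F \in ob PSh -> fobj eval (pair c F) = fobj F c.
Proof.
intros Hc HF. assert (Hp : pair c F \in ob D) by (apply mem_prod_pair; assumption).
unfold eval, comp_functor. rewrite fobj_mk by exact Hp.
unfold inclusion, id_functor. rewrite fobj_mk
  by (apply (functor_ob _ _ _ _ (app_functor_is_functor _ _) Hp)).
unfold app_functor. rewrite fobj_mk by exact Hp.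
rewrite fst_pair, snd_pair. reflexivity.
Qed.

Lemma app_fmap_eval c F d G f t x :
  c \in ob C -> F \in ob PSh -> d \in ob C -> G \in ob PSh ->
  f \in hom C d c -> t \in hom PSh F G -> x \in fobj F c ->
  app (fmap eval (pair c F) (pair d G) (pair f t)) x =
  app (app t d) (app (fmap F c d f) x).
Proof.
intros Hc HF Hd HG Hf Ht Hx.
assert (Hp : pair c F \in ob D) by (apply mem_prod_pair; assumption).
assert (Hq : pair d G \in ob D) by (apply mem_prod_pair; assumption).
assert (Hft : pair f t \in hom D (pair c F) (pair d G)).
{ apply mem_prod_pair; rewrite ?fst_pair, ?snd_pair; assumption. }
assert (Happ := app_functor_is_functor (op C) (small_sets U)).
unfold eval, comp_functor. rewrite fmap_mk by assumption.
(* The inclusion is a family over small sets and their functions only, so its argument must first be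
   shown to lie there. *)
unfold inclusion, id_functor. rewrite fmap_mk;
  [|exact (functor_ob _ _ _ _ Happ Hp)|exact (functor_ob _ _ _ _ Happ Hq)
   |exact (functor_hom _ _ _ _ _ _ Happ Hp Hq Hft)].
unfold app_functor. rewrite fmap_mk by assumption.
rewrite !fst_pair, !snd_pair. exact (app_fam _ Hx).
Qed.

Lemma fobj_Yid c F : c \in ob C -> F \in ob PSh ->
  fobj Yid (pair c F) = pair (yoneda_ob C c) F.
Proof.
intros Hc HF. assert (Hp : pair c F \in ob D) by (apply mem_prod_pair; assumption).
unfold Yid, prod_functor. rewrite fobj_mk by exact Hp.
rewrite fst_pair, snd_pair. unfold op_functor, id_functor, yoneda.
rewrite !fobj_mk by assumption. reflexivity.
Qed.

Lemma fobj_hom_yoneda c F : c \in ob C -> F \in ob PSh ->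
  fobj hom_yoneda (pair c F) =
  nat_trans (op C) (small_sets U) (yoneda_ob C c) F.
Proof.
intros Hc HF. assert (Hp : pair c F \in ob D) by (apply mem_prod_pair; assumption).
assert (Hq := functor_ob _ _ _ _ yoneda_id_is_functor Hp).
unfold hom_yoneda, comp_functor. rewrite fobj_mk by exact Hp.
unfold hom_functor. rewrite fobj_mk by exact Hq.
rewrite fobj_Yid, fst_pair, snd_pair by assumption. reflexivity.
Qed.

(** The transported transformation is [t] after [s] after postcomposition with [f], here evaluated
    at [g]. *)
Lemma app_fmap_hom_yoneda c F d G f t s a g :
  c \in ob C -> F \in ob PSh -> d \in ob C -> G \in ob PSh ->
  f \in hom C d c -> t \in hom PSh F G ->
  s \in nat_trans (op C) (small_sets U) (yoneda_ob C c) F ->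
  a \in ob C -> g \in hom C a d ->
  app (app (app (fmap hom_yoneda (pair c F) (pair d G) (pair f t)) s) a) g =
  app (app t a) (app (app s a) (comp C a d c f g)).
Proof.
intros Hc HF Hd HG Hf Ht Hs Ha Hg.
assert (Hp : pair c F \in ob D) by (apply mem_prod_pair; assumption).
assert (Hq : pair d G \in ob D) by (apply mem_prod_pair; assumption).
assert (Hft : pair f t \in hom D (pair c F) (pair d G)).
{ apply mem_prod_pair; rewrite ?fst_pair, ?snd_pair; assumption. }
assert (HYid := yoneda_id_is_functor).
unfold hom_yoneda, comp_functor. rewrite fmap_mk by assumption.
unfold hom_functor. rewrite fmap_mk;
  [|exact (functor_ob _ _ _ _ HYid Hp)|exact (functor_ob _ _ _ _ HYid Hq)
   |exact (functor_hom _ _ _ _ _ _ HYid Hp Hq Hft)].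
rewrite !fobj_Yid, !fst_pair, !snd_pair by assumption.
rewrite (app_fam (I := hom PSh (yoneda_ob C c) F) _ Hs).
unfold Yid, prod_functor. rewrite fmap_mk by assumption.
rewrite !fst_pair, !snd_pair.
unfold op_functor, id_functor. rewrite !fmap_mk by assumption.
unfold yoneda. rewrite fmap_mk by assumption.
cbn [comp PSh presheaves functor_cat ob op]. rewrite !(app_fam _ Ha).
cbn [comp small_sets set_cat]. rewrite fobj_yoneda_ob by exact Ha.
rewrite !(app_fam _ Hg). reflexivity.
Qed.

Lemma app_beta c F : c \in ob C -> F \in ob PSh ->
  app (beta U C) (pair c F) = fam (fobj F c) (beta_at C c F).
Proof.
intros Hc HF. unfold beta. rewrite app_fam by (apply mem_prod_pair; assumption).
rewrite fst_pair, snd_pair. reflexivity.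
Qed.

Lemma app_beta_hom c F : c \in ob C -> F \in ob PSh ->
  app (beta U C) (pair c F) \in
    functions (fobj eval (pair c F)) (fobj hom_yoneda (pair c F)).
Proof.
intros Hc HF. rewrite app_beta, fobj_eval, fobj_hom_yoneda by assumption.
apply fam_functions. intros x Hx. apply mem_functors in HF.
apply beta_at_nat_trans; assumption.
Qed.

(** Evaluated at [x] and then at [g] from [a] to [d], one side applies [F] along [f], then [t] at
    [d], then [G] along [g]; the other applies [F] along the composite of [f] and [g], then [t] at
    [a]. Naturality of [t] and functoriality of [F] identify them. *)
Lemma beta_is_nat_trans :
  is_nat_trans D (class_cat U 2) eval hom_yoneda (beta U C).
Proof.
split; [eexists; reflexivity|]. split.
- intros p Hp. apply mem_prod in Hp. destruct Hp as (c & F & Hc & HF & ->).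
  apply app_beta_hom; assumption.
- intros p q ft Hp Hq Hft.
  assert (He := functor_hom _ _ _ _ _ _ eval_is_functor Hp Hq Hft).
  assert (Hh := functor_hom _ _ _ _ _ _ hom_yoneda_is_functor Hp Hq Hft).
  apply mem_prod in Hp, Hq, Hft.
  destruct Hp as (c & F & Hc & HF & ->), Hq as (d & G & Hd & HG & ->),
    Hft as (f & t & Hf & Ht & ->).
  rewrite !fst_pair in Hf. rewrite !snd_pair in Ht.
  cbn [comp class_cat set_cat]. apply fam_ext. intros x Hx.
  assert (Hbx := functions_app _ _ _ _ (app_beta_hom c F Hc HF) Hx).
  assert (Hy := functions_app _ _ _ _ He Hx).
  assert (HL := functions_app _ _ _ _ (app_beta_hom d G Hd HG) Hy).
  assert (HR := functions_app _ _ _ _ Hh Hbx).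
  rewrite fobj_hom_yoneda in HL, HR, Hbx by assumption.
  rewrite fobj_eval in Hx, Hy by assumption.
  apply (set_nat_trans_ext _ _ _ _ HL HR). intros a g Ha Hg.
  rewrite fobj_yoneda_ob in Hg by exact Ha.
  rewrite app_fmap_hom_yoneda by assumption.
  rewrite (app_beta d G), (app_beta c F) by assumption.
  rewrite (app_fam _ Hx), (app_fam _ Hy), app_fmap_eval by assumption.
  assert (Hfg : comp C a d c f g \in hom C a c)
    by (apply (comp_hom (b := d)); assumption).
  rewrite !app_beta_at by assumption.
  apply mem_functors in HF.
  assert (Hz := set_functor_app F c d f x HF Hc Hd Hf Hx).
  (* Naturality of [t] along [g] puts [app t a] outermost on both sides, leaving an identity about
     [F] alone. *)
  rewrite <- (set_nat_trans_natural F G t d a g _ Ht Hd Ha Hg Hz).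
  f_equal. symmetry. apply (set_functor_comp F c d a g f x HF); assumption.
Qed.

(** The two composites with evaluation at the identity are [beta_at_idm] and [beta_at_yoneda]. *)
Lemma beta_iso p : p \in ob D ->
  is_iso (class_cat U 2) (fobj eval p) (fobj hom_yoneda p) (app (beta U C) p).
Proof.
intros Hp. apply mem_prod in Hp. destruct Hp as (c & F & Hc & HF & ->).
split; [apply app_beta_hom; assumption|].
rewrite app_beta, fobj_eval, fobj_hom_yoneda by assumption.
apply mem_functors in HF.
exists (fam (nat_trans (op C) (small_sets U) (yoneda_ob C c) F)
          (fun s => app (app s c) (idm C c))).
split; [|split].
- apply fam_functions. intros s Hs.
  apply nat_trans_yoneda_idm with (U := U); assumption.
- cbn [comp idm class_cat set_cat]. apply fam_ext. intros x Hx.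
  rewrite (app_fam _ Hx), app_fam by (apply beta_at_nat_trans; assumption).
  apply beta_at_idm with (U := U); assumption.
- cbn [comp idm class_cat set_cat]. apply fam_ext. intros s Hs.
  rewrite (app_fam _ Hs), app_fam
    by (apply nat_trans_yoneda_idm with (U := U); assumption).
  apply beta_at_yoneda with (U := U); assumption.
Qed.

End Proposition.

(** Functors carry neither source nor target, so the conjuncts before the last one record that each
    functor in the two composites has the intended type. *)
Theorem proposition11 (V : zfc) (U : V) (C : category V) :
  universe U -> light U C ->
  let PSh := presheaves U C in
  let Class2 := class_cat U 2 in
  (forall F G : V, F \in ob PSh -> G \in ob PSh ->
     hom PSh F G \in classes U 2) /\
  is_functor (prod_cat (op C) PSh) (small_sets U)
    (app_functor (op C) (small_sets U)) /\
  is_functor (small_sets U) Class2 (inclusion U) /\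
  is_functor C PSh (yoneda C) /\
  is_functor (prod_cat (op C) PSh) (prod_cat (op PSh) PSh)
    (prod_functor (op C) PSh (op_functor C (yoneda C)) (id_functor PSh)) /\
  is_functor (prod_cat (op PSh) PSh) Class2 (hom_functor PSh) /\
  is_nat_iso (prod_cat (op C) PSh) Class2
    (comp_functor (prod_cat (op C) PSh)
       (inclusion U)
       (app_functor (op C) (small_sets U)))
    (comp_functor (prod_cat (op C) PSh)
       (hom_functor PSh)
       (prod_functor (op C) PSh (op_functor C (yoneda C)) (id_functor PSh)))
    (beta U C).
Proof.
intros HU HC PSh Class2.
split; [exact (hom_presheaves_classes2 U C HU HC)|].
split; [apply app_functor_is_functor|].
split; [exact (set_inclusion_is_functor _ _ (universe_subset_classes2 U HU))|].
split; [exact (yoneda_is_functor U C HC)|].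
split; [exact (yoneda_id_is_functor U C HC)|].
split.
{ apply hom_functor_is_functor, hom_presheaves_classes2; assumption. }
split; [exact (eval_is_functor U C HU)|].
split; [exact (hom_yoneda_is_functor U C HU HC)|].
split; [exact (beta_is_nat_trans U C HU HC)|].
exact (beta_iso U C HC).
Qed.
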